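(* Let $C>0$ be a constant such that $|(1-x^2)^{1/4}g_n^{(\alpha,\beta)}(x)|\le C(2n+\alpha+\beta+1)^{-1/4}$ for all $x\in[-1,1]$, all real $\alpha,\beta\ge 0$ and all integers $n\ge 0$. Then $$|\sin 2\theta|^{1/2}\,\left|m^l_{pq}(k_\phi t_\theta k_{-\psi})\right|\le C\,(2l+1)^{-1/4}$$ for all $\phi,\theta,\psi\in\mathbb{R}$, all $l=0,\tfrac12,1,\tfrac32,\dots$ and all $p,q\in\{-l,-l+1,\dots,l\}$. Moreover, the exponent $1/4$ on the right-hand side is best possible: there do not exist constants $C'>0$ and $\varepsilon>0$ such that $|\sin 2\theta|^{1/2}\,|m^l_{pq}(k_\phi t_\theta k_{-\psi})|\le C'(2l+1)^{-1/4-\varepsilon}$ for all $\phi,\theta,\psi\in\mathbb{R}$, all $l=0,\tfrac12,1,\dots$ and all $p,q\in\{-l,-l+1,\dots,l\}$.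
   Context: For real $\alpha,\beta\ge0$ and an integer $n\ge0$, $P_n^{(\alpha,\beta)}$ is the Jacobi polynomial with the standard normalization $P_n^{(\alpha,\beta)}(x)=\frac{\Gamma(n+\alpha+1)}{\Gamma(\alpha+1)\Gamma(n+1)}\,{}_2F_1(-n,n+\alpha+\beta+1;\alpha+1;\frac{1-x}{2})$, and for $x\in[-1,1]$ $$g_n^{(\alpha,\beta)}(x)=\left(\frac{\Gamma(n+1)\,\Gamma(n+\alpha+\beta+1)}{\Gamma(n+\alpha+1)\Gamma(n+\beta+1)}\right)^{1/2}\left(\frac{1-x}2\right)^{\alpha/2}\left(\frac{1+x}2\right)^{\beta/2}P_n^{(\alpha,\beta)}(x).$$ For $l\in\{0,\tfrac12,1,\tfrac32,\dots\}$ let $\mathcal P_l$ be the $(2l+1)$-dimensional complex vector space of polynomials in two complex variables $z_1,z_2$ that are homogeneous of degree $2l$, and let $\pi_l$ be the irreducible representation of $\mathrm{SU}(2)$ on $\mathcal P_l$ given by $$\left[\pi_l\begin{pmatrix} a&b\\c&d\end{pmatrix} f\right](z_1,z_2)=f(az_1+cz_2,\;bz_1+dz_2).$$ For $p\in\{-l,-l+1,\dots,l\}$ let $h^l_p(z_1,z_2)=z_1^{l-p}z_2^{l+p}$. Equip $\mathcal P_l$ with an inner product for which $\pi_l$ is unitary (it is unique up to a positive scalar); the $h^l_p$ are then an orthogonal basis of $\mathcal P_l$, and $\hat h^l_p=h^l_p/\|h^l_p\|$ denote the normalized basis vectors. For $A\in\mathrm{SU}(2)$ put $$m^l_{pq}(A)=\langle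 \pi_l(A)\hat h^l_q,\hat h^l_p\rangle .$$ For $\phi,\theta\in\mathbb R$ let $$k_\phi=\begin{pmatrix} e^{i\phi}&0\\0&e^{-i\phi}\end{pmatrix},\qquad t_\theta=\begin{pmatrix}\cos\theta&-\sin\theta\\ \sin\theta&\cos\theta\end{pmatrix}.$$ *)

(* Defs.v *)
From HB Require Import structures.
From mathcomp Require Import all_boot all_order all_algebra.
(* [mpoly] has to be imported before MathComp-Analysis: in the other order
   their notations clash. *)
From mathcomp Require Import mpoly complex.
From mathcomp Require Import all_classical all_reals all_analysis.

Set Implicit Arguments.
Unset Strict Implicit.
Unset Printing Implicit Defensive.

Import Order.TTheory GRing.Theory Num.Theory.
Import numFieldNormedType.Exports.

Local Open Scope ring_scope.
Local Open Scope classical_set_scope.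
Local Open Scope complex_scope.

Section Jacobi.
Context {R : realType}.
Implicit Types (a b c s x z : R) (n k : nat).

(* Euler's integral; it is the usual value of Gamma at s only for 0 < s. *)
Definition Gamma s : R :=
  \int[lebesgue_measure]_(t in `]0, +oo[) (t `^ (s - 1) * expR (- t)).

Definition pochhammer a k : R := \prod_(i < k) (a + i%:R).

(* Gauss's series. *)
Definition hyp2F1 a b c z : R :=
  limn (series (fun k =>
    pochhammer a k * pochhammer b k / (pochhammer c k * k`!%:R) * z ^+ k)).

Definition jacobi n a b x : R :=
  Gamma (n%:R + a + 1) / (Gamma (a + 1) * Gamma (n%:R + 1)) *
  hyp2F1 (- n%:R) (n%:R + a + b + 1) (a + 1) ((1 - x) / 2).

(* The library has 0 `^ 0 = 1 and 0 `^ r = 0 for r != 0, so the values at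
   x = 1 and x = -1 are the intended ones. *)
Definition jacobi_g n a b x : R :=
  Num.sqrt (Gamma (n%:R + 1) * Gamma (n%:R + a + b + 1) /
            (Gamma (n%:R + a + 1) * Gamma (n%:R + b + 1))) *
  ((1 - x) / 2) `^ (a / 2) * ((1 + x) / 2) `^ (b / 2) * jacobi n a b x.

End Jacobi.

Section HomogeneousPolynomials.
Context {R : realType}.
Local Notation C := R[i].

(* The half-integer l is represented by N = 2l. *)
Definition Pl (N : nat) := dhomog 2 C N.

Definition z1 : {mpoly C[2]} := 'X_ord0.
Definition z2 : {mpoly C[2]} := 'X_ord_max.

Lemma dhomog_z1 : z1 \is 1.-homog.
Proof. by rewrite dhomogX /= mdeg1. Qed.

Lemma dhomog_z2 : z2 \is 1.-homog.
Proof. by rewrite dhomogX /= mdeg1. Qed.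

Lemma dhomog_exp1 (p : {mpoly C[2]}) k :
  p \is 1.-homog -> p ^+ k \is k.-homog.
Proof. by move=> hp; rewrite -[k in k.-homog]mul1n; apply: dhomogMn. Qed.

Lemma dhomog_comp_mpoly N (p q1 q2 : {mpoly C[2]}) :
    p \is N.-homog -> q1 \is 1.-homog -> q2 \is 1.-homog ->
  p \mPo [tuple q1; q2] \is N.-homog.
Proof.
move=> /dhomogP hp hq1 hq2; rewrite comp_mpolyEX big_seq.
apply: rpred_sum => m /hp mN; apply: dhomogZ.
rewrite comp_mpolyX 2!big_ord_recl big_ord0 mulr1.
rewrite -mN /= mdegE 2!big_ord_recl big_ord0 addn0.
by apply: dhomogM; apply: dhomog_exp1.
Qed.

Definition mx22 (a b c d : C) : 'M[C]_2 :=
  \matrix_(i, j) if i == 0 then (if j == 0 then a else b)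
                 else (if j == 0 then c else d).

Definition SU2 : {pred 'M[C]_2} :=
  [pred A | (A \is unitarymx) && (\det A == 1)].

Lemma dhomog_lin (a c : C) : a *: z1 + c *: z2 \is 1.-homog.
Proof. by apply: dhomogD; apply: dhomogZ; [exact: dhomog_z1|exact: dhomog_z2]. Qed.

(* f(z1, z2) |-> f(a z1 + c z2, b z1 + d z2) for A = (a b; c d). *)
Definition rep N (A : 'M[C]_2) (f : Pl N) : Pl N :=
  DHomog (dhomog_comp_mpoly (dhomog_is_dhomog f)
    (dhomog_lin (A 0 0) (A 1 0)) (dhomog_lin (A 0 1) (A 1 1))).

Lemma dhomog_hmono N (k : 'I_N.+1) :
  z1 ^+ (N - k) * z2 ^+ k \is N.-homog.
Proof.
rewrite -[N in N.-homog](@subnK k N) ?leq_ord//.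
by apply: dhomogM; apply: dhomog_exp1; [exact: dhomog_z1|exact: dhomog_z2].
Qed.

(* The weight p in {-l, ..., l} is represented by k = l + p in {0, ..., N},
   so that l - p = N - k and z1^(l-p) z2^(l+p) = z1^(N-k) z2^k. *)
Definition hvec N (k : 'I_N.+1) : Pl N := DHomog (dhomog_hmono k).

(* Forms of type [{dot _ for _}] are linear in the first argument,
   conjugate-linear in the second one, and positive definite. *)
Definition rep_unitary N (ip : {dot Pl N for (@Num.conj C)}) : Prop :=
  forall A, A \in SU2 -> forall f g, ip (rep A f) (rep A g) = ip f g.

Definition hhat N (ip : {dot Pl N for (@Num.conj C)}) (k : 'I_N.+1) : Pl N :=
  (sqrtC (ip (hvec k) (hvec k)))^-1 *: hvec k.

Definition mcoef N (ip : {dot Pl N for (@Num.conj C)}) (p q : 'I_N.+1)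
    (A : 'M[C]_2) : C :=
  ip (rep A (hhat ip q)) (hhat ip p).

Definition expi (phi : R) : C := cos phi +i* sin phi.

Definition kmx (phi : R) : 'M[C]_2 := mx22 (expi phi) 0 0 (expi (- phi)).

Definition tmx (theta : R) : 'M[C]_2 :=
  mx22 (cos theta)%:C (- sin theta)%:C (sin theta)%:C (cos theta)%:C.

End HomogeneousPolynomials.

(* Main.v *)
Require Import Defs.
From HB Require Import structures.
From mathcomp Require Import all_boot all_order all_algebra.
From mathcomp Require Import mpoly complex.
From mathcomp Require Import all_classical all_reals all_analysis.
From mathcomp Require Import measurable_realfun zify ring lra.

Set Implicit Arguments.
Unset Strict Implicit.
Unset Printing Implicit Defensive.

Import Order.TTheory GRing.Theory Num.Theory.
Import numFieldNormedType.Exports.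

Local Open Scope ring_scope.

(** The matrix coefficient [m_pq] at [k_phi t_theta k_(-psi)] is, up to a phase,
    a real sum in [cos theta] and [sin theta]: the coefficient of [z1^(N-p) z2^p]
    in a product of powers of two linear forms, rescaled by the norms of the
    monomials, which unitarity determines up to a common factor as
    [1 / binomial(N, k)].  The Chu-Vandermonde identity identifies this sum with
    [+- g_n^(a,b)(cos (2 theta))], where [2n + a + b = N], and
    [1 - cos^2 (2 theta) = sin^2 (2 theta)] turns the hypothesis into the bound.
    The exponent is sharp because at [theta = pi/4], [p = m], [q = 0], [N = 2m]
    one has [|m_pq|^2 = binomial(2m, m) / 4^m >= 1 / (2 sqrt m)]. *)

(** * Values of the Gamma function at positive integers *)

Section GammaFactorial.
Local Open Scope classical_set_scope.
Context {R : realType}.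
Implicit Types (x : R) (n : nat).

(** The antiderivative of [x ^+ n * expR (- x)] given by repeated integration by parts, normalized
    to vanish at infinity. *)
Fixpoint gamma_primitive n x : R :=
  if n is m.+1 then m.+1%:R * gamma_primitive m x - x ^+ m.+1 * expR (- x)
  else - expR (- x).

Lemma gamma_primitive0 n : gamma_primitive n 0 = - n`!%:R.
Proof.
elim: n => [|n IH] /=; first by rewrite oppr0 expR0 fact0.
by rewrite IH expr0n mul0r subr0 factS natrM mulrN.
Qed.

Lemma is_derive_gamma_primitive n x :
  is_derive x 1 (gamma_primitive n) (x ^+ n * expR (- x)).
Proof.
have expE : is_derive x 1 (fun y : R => expR (- y)) (- expR (- x)).
  by apply: is_derive_eq; rewrite /GRing.scale /= mulrN1.
elim: n => [|n IH]; rewrite /gamma_primitive -/gamma_primitive.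
  by apply: is_derive_eq; rewrite opprK expr0 mul1r.
have XE : is_derive x 1 (fun y : R => y ^+ n.+1) (n.+1%:R * x ^+ n).
  have := is_deriveX n.+1 (is_derive_id x (1 : R)).
  by rewrite /GRing.scale /= mulr1 exprfctE.
have cE : is_derive x 1 (fun y => n.+1%:R * gamma_primitive n y)
    (n.+1%:R * (x ^+ n * expR (- x))) by exact: is_deriveZ.
have := is_deriveB cE (is_deriveM XE expE).
move/is_derive_eq; apply.
rewrite /GRing.scale /= exprS; ring.
Qed.

Lemma cvg_exprn_expRN n : x ^+ n * expR (- x) @[x --> +oo] --> (0 : R).
Proof.
apply: (@squeeze_cvgr _ _ _ _ (cst 0) (fun x : R => n.+1`!%:R * x^-1)).
- near=> x.
  have x0 : 0 < x by near: x; exact: nbhs_pinfty_gt.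
  rewrite mulr_ge0 ?exprn_ge0 ?expR_ge0 ?(ltW x0)//= expRN.
  rewrite ler_pdivrMr ?expR_gt0// mulrAC ler_pdivlMr//.
  (* The degree [n.+1] term of the exponential series is a lower bound for [expR x]; this leaves a
     spare factor [x^-1]. *)
  have := expR_ge1Dxn n (ltW x0).
  have f0 : 0 < n.+1`!%:R :> R by rewrite ltr0n fact_gt0.
  move=> h; have : x ^+ n.+1 / n.+1`!%:R <= expR x.
    by apply: le_trans h; rewrite lerDr.
  by rewrite ler_pdivrMr// exprSr [_ * expR x]mulrC.
- exact: cvg_cst.
- rewrite -[X in _ --> X](mulr0 n.+1`!%:R); apply: cvgM; first exact: cvg_cst.
  apply/gtr0_cvgV0; last exact: cvg_id.
  near=> x; near: x; exact: nbhs_pinfty_gt.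
Unshelve. all: by end_near.
Qed.

Lemma cvg_gamma_primitive n : gamma_primitive n x @[x --> +oo] --> (0 : R).
Proof.
elim: n => [|n IH] /=.
  by rewrite -[X in _ --> X]oppr0; apply: cvgN; exact: cvgr_expR.
rewrite -[X in _ --> X](subr0 0); apply: cvgB; last exact: cvg_exprn_expRN.
by rewrite -[X in _ --> X](mulr0 n.+1%:R); apply: cvgM; first exact: cvg_cst.
Qed.

Lemma GammaS n : Gamma (n%:R + 1) = n`!%:R :> R.
Proof.
have cf : continuous (fun x : R => x ^+ n * expR (- x)).
  move=> x; apply: cvgM; first exact: exprn_continuous.
  apply: (@continuous_comp _ _ _ -%R (@expR R)); first exact: opp_continuous.
  exact: continuous_expR.
transitivity (\int[@lebesgue_measure R]_(x in `]0%R, +oo[%classic)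
    (x ^+ n * expR (- x))).
  apply: eq_Rintegral => x; rewrite inE /= in_itv /= andbT => x0.
  by rewrite addrK powR_mulrn// ltW.
rewrite /Rintegral integral_itv_obnd_cbnd; last first.
  apply/measurable_EFinP; apply: measurable_funS (measurableT) _ _ => //.
  exact: continuous_measurable_fun.
have := @Rintegral_ge0_continuous_FTC2y R
  (fun x => x ^+ n * expR (- x)) (gamma_primitive n) 0 0.
rewrite gamma_primitive0 sub0r opprK /Rintegral => -> //.
- by move=> x x0; rewrite mulr_ge0 ?exprn_ge0 ?expR_ge0.
- exact: continuous_subspaceT.
- exact: cvg_gamma_primitive.
- by move=> x _; have [] := is_derive_gamma_primitive n x.
- rewrite -gamma_primitive0; apply: cvg_at_right_filter.
  apply: differentiable_continuous; apply/derivable1_diffP.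
  by have [] := is_derive_gamma_primitive n 0.
- move=> x _; rewrite derive1E.
  exact: (@derive_val _ _ _ _ _ _ _ (is_derive_gamma_primitive n x)).
Qed.

End GammaFactorial.

(** * Matrix coefficients in the monomial basis *)

Section Coefficients.
Context {R : realType}.
Local Notation C := R[i].
Local Notation conj := (@Num.conj C).
Local Open Scope complex_scope.

(** Homogenization, P(X) to z1^M P(z2/z1), is multiplicative, so the coefficients of a product of
    linear forms can be read off a product of univariate polynomials. *)
Lemma homogenize_linear_factors N q (a b c d : C) : (q <= N)%N ->
  (a *: z1 + c *: z2) ^+ (N - q) * (b *: z1 + d *: z2) ^+ q =
  \sum_(k < N.+1) ((a%:P + c *: 'X) ^+ (N - q) * (b%:P + d *: 'X) ^+ q)`_k *:
    (z1 ^+ (N - k) * z2 ^+ k) :> {mpoly C[2]}.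
Proof.
pose hom M (P : {poly C}) : {mpoly C[2]} :=
  \sum_(k < M.+1) P`_k *: (z1 ^+ (M - k) * z2 ^+ k).
(* One linear factor at a time; [hom M] drops all coefficients beyond degree [M], hence the size
   bound. *)
have homM M (P : {poly C}) u v : (size P <= M.+1)%N ->
    hom M.+1 (P * (u%:P + v *: 'X)) = hom M P * (u *: z1 + v *: z2).
  move=> sP; rewrite /hom.
  have coefE k : (P * (u%:P + v *: 'X))`_k =
      u * P`_k + v * (if k is k'.+1 then P`_k' else 0).
    rewrite mulrDr coefD coefMC mulrC -scalerAr coefZ coefMX.
    by case: k.
  under eq_bigr => k _ do rewrite coefE scalerDl -!scalerA.
  rewrite big_split /= -!scaler_sumr mulrDr -!scalerAr; congr (_ *: _ + _ *: _).
    rewrite big_ord_recr /= nth_default// scale0r addr0 mulr_suml.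
    apply: eq_bigr => k _; rewrite -scalerAl mulrAC -exprSr subSn//.
    by rewrite -ltnS.
  rewrite big_ord_recl scale0r add0r mulr_suml; apply: eq_bigr => k _ /=.
  by rewrite /bump /= add1n subSS -scalerAl -mulrA -exprSr.
have lin_size (u v : C) n : (size ((u%:P + v *: 'X) ^+ n) <= n.+1)%N.
  apply: leq_trans (size_poly_exp_leq _ _) _; rewrite ltnS.
  rewrite -[leqRHS]mul1n leq_mul2r; apply/orP; right.
  rewrite -subn1 leq_subLR add1n.
  apply: leq_trans (size_polyD _ _) _; rewrite geq_max.
  rewrite (leq_trans (size_polyC_leq1 _))//=.
  by rewrite (leq_trans (size_scale_leq _ _))// size_polyX.
have main M1 M2 : hom (M1 + M2)%N
    ((a%:P + c *: 'X) ^+ M1 * (b%:P + d *: 'X) ^+ M2) =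
    (a *: z1 + c *: z2) ^+ M1 * (b *: z1 + d *: z2) ^+ M2.
  elim: M2 => [|M2 IH2].
    rewrite !expr0 !mulr1 addn0; elim: M1 => [|M1 IH1].
      by rewrite /hom big_ord1 !expr0 coef1 mulr1 scale1r.
    by rewrite !exprSr homM ?lin_size// IH1.
  rewrite addnS !exprSr !mulrA homM ?IH2//.
  apply: leq_trans (size_polyMleq _ _) _.
  rewrite -subn1 leq_subLR add1n.
  apply: leq_trans (leq_add (lin_size _ _ _) (lin_size _ _ _)) _.
  by rewrite addSn addnS.
by move=> qN; rewrite -main subnK.
Qed.

(** The entry in row [p] and column [q] of [rep A] in the unnormalized basis [hvec], read off after
    setting z1 = 1 and z2 = ['X]. *)
Definition rep_coef N (A : 'M[C]_2) (p q : nat) : C :=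
  (((A 0 0)%:P + A 1 0 *: 'X) ^+ (N - q) * ((A 0 1)%:P + A 1 1 *: 'X) ^+ q)`_p.

Lemma rep_hvec N (A : 'M[C]_2) (q : 'I_N.+1) :
  rep A (hvec q) = \sum_(k < N.+1) rep_coef N A k q *: hvec k.
Proof.
apply: val_inj; rewrite /= raddf_sum /=.
rewrite rmorphM !rmorphXn /= /z1 /z2 !comp_mpolyXU /=.
by rewrite homogenize_linear_factors ?leq_ord.
Qed.

Lemma coef_linear_exp (K : comNzRingType) (a b : K) n k :
  ((a%:P + b *: 'X) ^+ n)`_k = a ^+ (n - k) * b ^+ k *+ 'C(n, k).
Proof.
rewrite exprDn coef_sum.
have termE i : (a%:P ^+ (n - i) * (b *: 'X) ^+ i *+ 'C(n, i))`_k =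
    (a ^+ (n - k) * b ^+ k *+ 'C(n, k)) *+ (k == i).
  rewrite coefMn -rmorphXn coefCM exprZn coefZ coefXn.
  by case: eqP => [->|_] /=; rewrite ?mulr1 ?mulr0 ?mul0rn ?mulr1n ?mulr0n.
under eq_bigr do rewrite termE.
have [kn|kn] := ltnP k n.+1.
  rewrite (bigD1 (Ordinal kn)) //= eqxx mulr1n big1 ?addr0// => i.
  by rewrite -val_eqE /= eq_sym => /negPf ->.
rewrite bin_small// mulr0n big1// => i _.
by rewrite mul0rn.
Qed.

Lemma rep_coefE N (A : 'M[C]_2) p q : rep_coef N A p q =
  \sum_(j < p.+1) (A 0 0 ^+ (N - q - j) * A 1 0 ^+ j *+ 'C(N - q, j)) *
    (A 0 1 ^+ (q - (p - j)) * A 1 1 ^+ (p - j) *+ 'C(q, p - j)).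
Proof.
rewrite /rep_coef coefM; apply: eq_bigr => j _.
by rewrite !coef_linear_exp.
Qed.

Lemma expi0 : expi 0 = 1 :> C.
Proof. by rewrite /expi cos0 sin0. Qed.

Lemma expiD (x y : R) : expi (x + y) = expi x * expi y.
Proof.
rewrite /expi cosD sinD; apply/eqP; rewrite eq_complex /=; apply/andP.
by split; apply/eqP; ring.
Qed.

Lemma expiX (x : R) n : expi x ^+ n = expi (x * n%:R).
Proof.
elim: n => [|n IH]; first by rewrite mulr0 expi0.
by rewrite exprS IH -expiD -natr1 mulrDr mulr1 addrC.
Qed.

Lemma conj_expi (x : R) : conj (expi x) = expi (- x).
Proof. by rewrite /expi cosN sinN; apply/eqP; rewrite eq_complex /= !eqxx. Qed.

Lemma expi_pi : expi pi = - 1 :> C.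
Proof.
by rewrite /expi cospi sinpi; apply/eqP; rewrite eq_complex /= oppr0 !eqxx.
Qed.

Lemma normc_expi (x : R) : ComplexField.Normc.normc (expi x) = 1.
Proof. by rewrite /= cos2Dsin2 sqrtr1. Qed.

Lemma normc_ge0 (z : C) : 0 <= ComplexField.Normc.normc z.
Proof. by case: z => x y; exact: sqrtr_ge0. Qed.

Lemma mx22_SU2 (a b : C) : a * conj a + b * conj b = 1 ->
  mx22 a b (- conj b) (conj a) \in SU2.
Proof.
move=> ab1; rewrite inE; apply/andP; split.
  apply/unitarymxP/matrixP => i j; rewrite !mxE 2!big_ord_recl big_ord0 addr0.
  rewrite !mxE; case: i => [[|[|//]] hi]; case: j => [[|[|//]] hj] //=.
  - by rewrite rmorphN /= !conjCK; ring.
  - ring.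
  - by rewrite rmorphN /= !conjCK -ab1; ring.
rewrite (expand_det_row _ 0) 2!big_ord_recl big_ord0 addr0.
by rewrite /cofactor !det_mx11 !mxE /= expr0 expr1 mul1r mulN1r opprK ab1.
Qed.

Lemma kmx_SU2 (phi : R) : kmx phi \in SU2.
Proof.
have := @mx22_SU2 (expi phi) 0.
rewrite mul0r addr0 conj_expi -expiD subrr expi0 => /(_ erefl).
by rewrite rmorph0 oppr0.
Qed.

Lemma tmx_SU2 (theta : R) : tmx theta \in SU2.
Proof.
have := @mx22_SU2 (cos theta)%:C (- sin theta)%:C.
have conjR (x : R) : conj x%:C = x%:C.
  by apply/eqP; rewrite eq_complex /= oppr0 !eqxx.
rewrite !conjR -!rmorphM -rmorphD -rmorphN /= opprK => /(_ _); apply.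
by rewrite mulrNN -!expr2 cos2Dsin2.
Qed.

End Coefficients.

(** * Orthogonality and norms of the monomials under a unitary form *)

Section UnitaryForm.
Context {R : realType}.
Local Notation C := R[i].
Local Notation conj := (@Num.conj C).
Local Open Scope complex_scope.
Context (N : nat) (ip : {dot @Pl R N for conj}) (ip_unitary : rep_unitary ip).

Lemma rep_kmx_hvec (phi : R) (q : 'I_N.+1) :
  rep (kmx phi) (hvec q) = expi (phi * (N%:R - 2 * q%:R)) *: hvec q.
Proof.
rewrite rep_hvec (bigD1 q) //= big1 ?addr0 => [|k kq]; last first.
  rewrite /rep_coef !mxE /= scale0r add0r addr0 -rmorphXn coefCM exprZn coefZ coefXn.
  by rewrite val_eqE (negPf kq) !mulr0 scale0r.
congr (_ *: _); rewrite /rep_coef !mxE /= scale0r add0r addr0 -rmorphXn.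
rewrite coefCM exprZn coefZ coefXn eqxx mulr1 !expiX -expiD; congr expi.
by rewrite natrB ?leq_ord//; ring.
Qed.

(** Both vectors are eigenvectors of every [kmx phi]. The chosen angle makes the product of one
    eigenvalue with the conjugate of the other equal to e^(i pi) = -1, so the inner product is its
    own opposite. *)
Lemma hvec_orthogonal (p q : 'I_N.+1) : p != q -> ip (hvec p) (hvec q) = 0.
Proof.
move=> pq; have d0 : q%:R - p%:R != 0 :> R.
  by rewrite subr_eq0 eqr_nat val_eqE eq_sym.
have := ip_unitary (kmx_SU2 (pi / (2 * (q%:R - p%:R)))) (hvec p) (hvec q).
rewrite !rep_kmx_hvec linearZl_LR linearZr_LR /= conj_expi mulrA -expiD.
set x := (X in expi X); have -> : x = pi by rewrite /x; field.
rewrite expi_pi mulN1r => /eqP; rewrite -subr_eq0 -opprD oppr_eq0 -mulr2n.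
by rewrite mulrn_eq0 /= => /eqP.
Qed.

Lemma ip_sum_hvec (u v : 'I_N.+1 -> C) :
  ip (\sum_k u k *: hvec k) (\sum_k v k *: hvec k) =
  \sum_k u k * conj (v k) * ip (hvec k) (hvec k).
Proof.
rewrite linear_sumlz; apply: eq_bigr => k _.
rewrite linear_sumr (bigD1 k) //= big1 ?addr0 => [|j jk].
  by rewrite linearZl_LR linearZr_LR /= mulrA.
by rewrite linearZl_LR linearZr_LR /= hvec_orthogonal ?mulr0// eq_sym.
Qed.

Lemma hvec_neq0 (k : 'I_N.+1) : hvec k != 0 :> @Pl R N.
Proof.
apply/eqP => /(congr1 val) /= /(congr1 (mcoeff (U_(ord0) *+ (N - k) + U_(ord_max) *+ k))).
rewrite /z1 /z2 !mpolyXn -mpolyXD mcoeffX eqxx mcoeff0.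
by move/eqP; rewrite oner_eq0.
Qed.

Lemma hvec_norm_gt0 (k : 'I_N.+1) : 0 < ip (hvec k) (hvec k).
Proof. by rewrite dnorm_gt0 hvec_neq0. Qed.

(* Comparing the norms of [hvec 0] and of its image under rotations with
   tangent [m] gives a polynomial identity in [m ^ 2]. *)
Lemma hvec_norm (k : 'I_N.+1) :
  ip (hvec k) (hvec k) * 'C(N, k)%:R = ip (hvec ord0) (hvec ord0).
Proof.
pose h j := ip (hvec j) (hvec j).
(* With t = tan^2 x, invariance of the norm of [hvec ord0] reads: the sum of h_j C(N,j)^2 t^j equals
   h_0 (1+t)^N. [P] is the difference of the two sides. *)
pose P : {poly C} := \sum_(j < N.+1)
  (h j * 'C(N, j)%:R ^+ 2 - h ord0 * 'C(N, j)%:R) *: 'X^j.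
have Proot m : root P (m%:R ^+ 2).
  pose x : R := atan m%:R.
  have cx0 : cos x != 0.
    by rewrite /x cos_atan invr_eq0 sqrtr_eq0 -ltNge ltr_pwDl ?sqr_ge0.
  have sx : sin x = m%:R * cos x.
    by rewrite -[m%:R]atanK -/x /tan divfK.
  have := ip_unitary (tmx_SU2 x) (hvec ord0) (hvec ord0).
  rewrite rep_hvec ip_sum_hvec -/(h ord0).
  have coefE (j : 'I_N.+1) : rep_coef N (tmx x) j (ord0 : 'I_N.+1) =
      (cos x ^+ N * m%:R ^+ j * 'C(N, j)%:R)%:C.
    rewrite /rep_coef !mxE /= expr0 mulr1 coef_linear_exp subn0.
    rewrite -!rmorphXn -rmorphM -rmorphMn /= sx; congr (_%:C).
    rewrite -[in cos x ^+ N](subnK (leq_ord j)) exprD exprMn.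
    by rewrite -[_ *+ 'C(N, j)]mulr_natr ?natrX; ring.
  have conjE (y : R) : conj y%:C = y%:C.
    by apply/eqP; rewrite eq_complex /= oppr0 !eqxx.
  under eq_bigr => j _ do rewrite coefE conjE -/(h j).
  set k2 : C := (cos x)%:C ^+ (N * 2); move=> hsum.
  have k20 : k2 != 0 by rewrite expf_neq0// (inj_eq (@complexI R) _ 0).
  have kE : k2 * \sum_(j < N.+1) 'C(N, j)%:R * (m%:R ^+ 2) ^+ j = 1.
    rewrite /k2 mulnC exprM.
    have -> : \sum_(j < N.+1) 'C(N, j)%:R * (m%:R ^+ 2) ^+ j = (1 + m%:R ^+ 2) ^+ N :> C.
      by rewrite exprDn; apply: eq_bigr => j _; rewrite expr1n mul1r mulr_natl.
    rewrite -exprMn -[RHS](expr1n _ N); congr (_ ^+ N).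
    rewrite -(rmorph_nat (real_complex R)) -!(rmorphXn (real_complex R)).
    rewrite -[1](rmorph1 (real_complex R)).
    rewrite -rmorphD -rmorphM; congr (_%:C).
    by rewrite mulrDr mulr1 -exprMn [cos x * _]mulrC -sx cos2Dsin2.
  apply/eqP/(mulfI k20); rewrite mulr0 horner_sum mulr_sumr.
  transitivity (h ord0 - h ord0 * (k2 * \sum_(j < N.+1) 'C(N, j)%:R * (m%:R ^+ 2) ^+ j)).
    rewrite -[X in X - _]hsum !mulr_sumr -sumrB; apply: eq_bigr => j _.
    rewrite hornerZ hornerXn !rmorphM /= !rmorphXn /= !rmorph_nat /k2 exprM.
    rewrite [(m%:R ^+ 2) ^+ j]exprAC; ring.
  by rewrite kE mulr1 subrr.
(* The squares of 0, ..., N are N+1 distinct roots, while the degree is at most N. *)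
have P0 : P = 0.
  pose rs : seq C := [seq (m%:R ^+ 2) | m <- iota 0 N.+1].
  apply: (@roots_geq_poly_eq0 _ P rs).
  - by apply/allP => y /mapP [m _ ->].
  - rewrite map_inj_uniq ?iota_uniq// => m n /eqP.
    by rewrite eqrXn2 ?ler0n// eqr_nat => /eqP.
  - rewrite size_map size_iota; apply: leq_trans (size_sum _ _ _) _.
    apply/bigmax_leqP => j _.
    by rewrite (leq_trans (size_scale_leq _ _))// size_polyXn ltnS leq_ord.
have := congr1 (fun p : {poly C} => p`_k) P0.
rewrite coef0 coef_sum (bigD1 k) //= big1 ?addr0 => [|j jk]; last first.
  by rewrite coefZ coefXn val_eqE eq_sym (negPf jk) mulr0.
rewrite coefZ coefXn eqxx mulr1 expr2 mulrA -mulrBl => /eqP.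
rewrite mulf_eq0 pnatr_eq0 -leqn0 leqNgt bin_gt0 leq_ord orbF subr_eq0.
by move/eqP.
Qed.

Lemma repZ (A : 'M[C]_2) a (f : @Pl R N) : rep A (a *: f) = a *: rep A f.
Proof. by apply: val_inj; rewrite /= comp_mpolyZ. Qed.

(** By orthogonality, normalizing the basis multiplies the squared coefficient by the ratio of the
    squared norms of [hvec p] and [hvec q], which [hvec_norm] turns into binomials. *)
Lemma normc_mcoef_sqr (p q : 'I_N.+1) (A : 'M[C]_2) :
  ComplexField.Normc.normc (mcoef ip p q A) ^+ 2 =
  ComplexField.Normc.normc (rep_coef N A p q) ^+ 2 * 'C(N, q)%:R / 'C(N, p)%:R.
Proof.
have normcE (z : C) : (ComplexField.Normc.normc z ^+ 2)%:C = `|z| ^+ 2.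
  by rewrite rmorphXn.
apply: (@complexI R); rewrite normcE -mulrA rmorphM /= normcE.
rewrite fmorph_div /= !rmorph_nat.
have mE : mcoef ip p q A = (sqrtC (ip (hvec q) (hvec q)))^-1 *
    (conj (sqrtC (ip (hvec p) (hvec p)))^-1 *
      (rep_coef N A p q * ip (hvec p) (hvec p))).
  rewrite /mcoef /hhat repZ linearZl_LR linearZr_LR /=; congr (_ * (_ * _)).
  rewrite rep_hvec linear_sumlz (bigD1 p) //= big1 ?addr0 => [|k kp].
    by rewrite linearZl_LR.
  by rewrite linearZl_LR /= hvec_orthogonal// mulr0.
have hq0 := hvec_norm_gt0 q; have hp0 := hvec_norm_gt0 p.
have hpq : ip (hvec p) (hvec p) * 'C(N, p)%:R =
    ip (hvec q) (hvec q) * 'C(N, q)%:R by rewrite !hvec_norm.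
have bp0 : 'C(N, p)%:R != 0 :> C by rewrite pnatr_eq0 -lt0n bin_gt0 leq_ord.
rewrite mE !normrM norm_conjC !normfV !exprMn !exprVn.
rewrite !(ger0_norm (_ : 0 <= sqrtC _)) ?sqrtC_ge0 ?ltW// !sqrtCK.
rewrite (ger0_norm (ltW hp0)).
set hp := ip (hvec p) _ in hpq hp0 *; set hq := ip (hvec q) _ in hpq hq0 *.
have -> : 'C(N, q)%:R = hp * 'C(N, p)%:R / hq :> C.
  by rewrite hpq mulrAC mulfV ?mul1r// gt_eqF.
by field; rewrite bp0 !gt_eqF.
Qed.

End UnitaryForm.

(** * Removal of the phases *)

Section Rotation.
Context {R : realType}.
Local Notation C := R[i].
Local Open Scope complex_scope.

(** The sum of [rep_coefE] for the rotation with cosine [c] and sine [s]; [c] and [s] are kept as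
    independent variables. *)
Definition rot_coef N p q (c s : R) : R :=
  \sum_(j < p.+1) (c ^+ (N - q - j) * s ^+ j *+ 'C(N - q, j)) *
    ((- s) ^+ (q - (p - j)) * c ^+ (p - j) *+ 'C(q, p - j)).

(** [u] and [v] scale the columns and [w] the second row; every nonzero term of the sum has degree
    N-q in the first column, q in the second column and p in the second row. *)
Lemma rep_coef_phase N p q (u v w a b c d : C) :
  rep_coef N (mx22 (u * a) (v * b) (u * w * c) (v * w * d)) p q =
  u ^+ (N - q) * v ^+ q * w ^+ p * rep_coef N (mx22 a b c d) p q.
Proof.
have expE n j (x y z t : C) : (x * y) ^+ (n - j) * (x * z * t) ^+ j *+ 'C(n, j) =
    x ^+ n * z ^+ j * (y ^+ (n - j) * t ^+ j *+ 'C(n, j)).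
  (* For [j > n] the truncated exponent is wrong, but the binomial vanishes. *)
  have [jn|jn] := leqP j n; last by rewrite bin_small// !mulr0n mulr0.
  by rewrite -[in x ^+ n](subnK jn) exprD !exprMn mulrnAr; congr (_ *+ _); ring.
rewrite !rep_coefE mulr_sumr; apply: eq_bigr => j _.
rewrite !mxE /= !expE.
by rewrite -[in w ^+ p](subnK (leq_ord j)) exprD; ring.
Qed.

Lemma normc_rep_coef_rotation N p q (phi theta psi : R) :
  ComplexField.Normc.normc
    (rep_coef N (kmx phi *m tmx theta *m kmx (- psi)) p q) =
  `|rot_coef N p q (cos theta) (sin theta)|.
Proof.
have -> : kmx phi *m tmx theta *m kmx (- psi) =
    mx22 (expi (phi - psi) * (cos theta)%:C) (expi (phi + psi) * (- sin theta)%:C)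
      (expi (phi - psi) * expi (- phi *+ 2) * (sin theta)%:C)
      (expi (phi + psi) * expi (- phi *+ 2) * (cos theta)%:C).
  apply/matrixP => i j; rewrite !mxE 2!big_ord_recl big_ord0 addr0.
  rewrite !mxE 2!big_ord_recl big_ord0 addr0 !mxE.
  rewrite !big_ord_recl big_ord0 !mxE.
  case: i => [[|[|//]] hi]; case: j => [[|[|//]] hj] //=;
    rewrite ?opprK !(mulr0, mul0r, add0r, addr0) mulrAC -!expiD;
    congr (expi _ * _); ring.
rewrite rep_coef_phase !ComplexField.Normc.normcM.
rewrite !expiX !normc_expi !mul1r.
have -> : rep_coef N (mx22 (cos theta)%:C (- sin theta)%:C (sin theta)%:C
    (cos theta)%:C) p q = (rot_coef N p q (cos theta) (sin theta))%:C.
  rewrite rep_coefE rmorph_sum; apply: eq_bigr => j _.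
  by rewrite !mxE /= rmorphM !rmorphMn !rmorphM !rmorphXn.
by rewrite /= expr0n addr0 sqrtr_sqr.
Qed.

End Rotation.

(** * Binomial identities for the rotation coefficients *)

Section Combinatorics.
Context {R : realType}.
Implicit Types (c s y : R).

Local Notation fact n := (n`!%:R : R).

Lemma factR_neq0 n : fact n != 0.
Proof. by rewrite pnatr_eq0 -lt0n fact_gt0. Qed.

Lemma natr_binD m n : 'C(m + n, m)%:R = fact (m + n) / (fact m * fact n).
Proof.
rewrite -(@bin_fact (m + n) m) ?leq_addr// addKn !natrM.
by field; rewrite !factR_neq0.
Qed.

(** Isolates the factor C(b,i) i! of [jacobi_sum]; both sides vanish for [i > b]. *)
Lemma natr_bin_shift a b i :
  'C(a + b, a + i)%:R = fact (a + b) / fact b * ('C(b, i) * i`!)%:R / fact (a + i).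
Proof.
have [ib|ib] := leqP i b; last by rewrite !bin_small ?ltn_add2l// mul0n mulr0 mul0r.
move: (b - i)%N (subnKC ib) => d <-.
rewrite addnA natr_binD natrM natr_binD.
by field; rewrite !factR_neq0.
Qed.

(* For q <= b this is, up to a factorial factor, c^(b-q) times the Jacobi
   polynomial P_q^(a,b-q) at c^2 - s^2; the symmetry in q and b saves half of
   the case distinctions on p and q. *)
Definition jacobi_sum q b a c s : R :=
  \sum_(i < q.+1) (-1) ^+ i * ('C(q, i) * 'C(b, i) * i`!)%:R / fact (a + i) *
    s ^+ (i * 2) * c ^+ (q + b - i * 2).

(** The summand is symmetric in [q] and [b]; only the range is not, and it can be extended because
    the binomials vanish beyond it. *)
Lemma jacobi_sumC q b a c s : jacobi_sum q b a c s = jacobi_sum b q a c s.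
Proof.
pose F q b i := (-1) ^+ i * ('C(q, i) * 'C(b, i) * i`!)%:R / fact (a + i) *
  s ^+ (i * 2) * c ^+ (q + b - i * 2).
suff widen n m : jacobi_sum n m a c s = \sum_(i < (n + m).+1) F n m i.
  by rewrite !widen addnC; apply: eq_bigr => i _; rewrite /F [(q + b)%N]addnC
     [('C(q, i) * _)%N]mulnC.
rewrite /jacobi_sum (big_ord_widen (n + m).+1 (F n m)) ?ltnS ?leq_addr//.
rewrite big_mkcond; apply: eq_bigr => i _; case: ifPn => //.
by rewrite ltnS -ltnNge => ni; rewrite /F bin_small// !mul0n mulr0 !mul0r.
Qed.

Lemma rot_coef_ge q a b c s :
  rot_coef (q + a + b) (q + a) q c s =
  s ^+ a * (fact (a + b) / fact b) * jacobi_sum q b a c s.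
Proof.
rewrite /rot_coef -(big_mkord xpredT (fun j =>
  (c ^+ (q + a + b - q - j) * s ^+ j *+ 'C(q + a + b - q, j)) *
  ((- s) ^+ (q - (q + a - j)) * c ^+ (q + a - j) *+ 'C(q, q + a - j)))).
(* The terms with [j < a] contain C(q, q+a-j) = 0; the others are reindexed by j = a + i. *)
rewrite (@big_cat_nat _ _ _ a) //=; last by rewrite -addSn leq_addl.
rewrite big1_seq ?add0r => [|j]; last first.
  rewrite mem_index_iota => /andP[_ /andP[_ ja]].
  by rewrite (bin_small (_ : q < q + a - j)%N) ?mulr0n ?mulr0//; lia.
rewrite -{1}[a]add0n big_addn big_mkord mulr_sumr.
have -> : ((q + a).+1 - a = q.+1)%N by lia.
apply: eq_bigr => i _.
have iq : (i <= q)%N by rewrite -ltnS.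
have -> : (q + a + b - q = a + b)%N by lia.
have -> : (q + a - (i + a) = q - i)%N by lia.
rewrite subKn// bin_sub// [(i + a)%N]addnC.
rewrite -[_ *+ 'C(a + b, _)]mulr_natr -[_ *+ 'C(q, _)]mulr_natr natr_bin_shift.
have [ib|ib] := leqP i b; last first.
  by rewrite (bin_small ib) !(muln0, mul0n, mulr0, mul0r).
have -> : (a + b - (a + i) = b - i)%N by lia.
have -> : (q + b - i * 2 = (b - i) + (q - i))%N by lia.
rewrite !exprD exprM [(- s) ^+ _]exprNn !natrM.
by field; rewrite !factR_neq0.
Qed.

(** The case of weights with p at most q. The powers of [- s] now have exponent a + i, whence the
    sign [(-1) ^+ a]. *)
Lemma rot_coef_le p a b c s :
  rot_coef (p + a + b) p (p + a) c s =
  (-1) ^+ a * (s ^+ a * (fact (p + a) / fact p) * jacobi_sum p b a c s).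
Proof.
rewrite /rot_coef !mulr_sumr; apply: eq_bigr => i _.
have ip : (i <= p)%N by rewrite -ltnS.
have -> : (p + a + b - (p + a) = b)%N by lia.
have -> : (p + a - (p - i) = a + i)%N by lia.
have -> : 'C(p + a, p - i) = 'C(a + p, a + i).
  by rewrite addnC -bin_sub; [congr 'C(_, _); lia|lia].
rewrite -[_ *+ 'C(b, _)]mulr_natr -[_ *+ 'C(a + p, _)]mulr_natr natr_bin_shift.
have [ib|ib] := leqP i b; last first.
  by rewrite (bin_small ib) !(muln0, mul0n, mulr0, mul0r).
have -> : (p + b - i * 2 = (b - i) + (p - i))%N by lia.
rewrite [(p + a)%N]addnC !exprD exprM [(- s) ^+ a]exprNn [(- s) ^+ i]exprNn !natrM.
by field; rewrite !factR_neq0.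
Qed.

(* The witnesses are n = min(p, q, N - p, N - q), a = |p - q| and b = |N - p - q|. *)
Lemma rot_coef_sqr N p q c s : (p <= N)%N -> (q <= N)%N ->
  exists n a b, (n * 2 + a + b = N)%N /\
    rot_coef N p q c s ^+ 2 * 'C(N, q)%:R / 'C(N, p)%:R =
    fact (n + a) * fact (n + b + a) / (fact n * fact (n + b)) *
      (s ^+ a * jacobi_sum n (n + b) a c s) ^+ 2.
Proof.
move=> pN qN.
(* Since [M] is symmetric in its first two arguments, these need only be found up to order; the
   smaller one becomes the degree. *)
pose M q b a := fact (q + a) * fact (b + a) / (fact q * fact b) *
      (s ^+ a * jacobi_sum q b a c s) ^+ 2.
have MC m b a : M m b a = M b m a.
  by rewrite /M jacobi_sumC [fact (m + a) * _]mulrC [fact m * _]mulrC.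
suff [m [b [a [mN ->]]]] : exists m b a, (m + b + a = N)%N /\
    rot_coef N p q c s ^+ 2 * 'C(N, q)%:R / 'C(N, p)%:R = M m b a.
  have [mb|bm] := leqP m b.
    by exists m, a, (b - m)%N; split; [lia|rewrite subnKC].
  exists b, a, (m - b)%N; split; first lia.
  by rewrite MC subnKC// ltnW.
have [qp|/ltnW pq] := leqP q p.
  exists q, (N - p)%N, (p - q)%N; split; first lia.
  move: (N - p)%N (p - q)%N (subnKC pN) (subnKC qp) => b a <- <-.
  rewrite rot_coef_ge /M natr_binD -addnA natr_binD [(b + a)%N]addnC.
  by field; rewrite !factR_neq0.
exists p, (N - q)%N, (q - p)%N; split; first lia.
move: (N - q)%N (q - p)%N (subnKC qN) (subnKC pq) => b a <- <-.
rewrite rot_coef_le /M natr_binD -addnA natr_binD [(b + a)%N]addnC.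
rewrite exprMn sqrr_sign mul1r.
by field; rewrite !factR_neq0.
Qed.

(** Vandermonde's identity for C(m + (a+k), k), rescaled by k!/(a+k)!. *)
Lemma sum_bin_fact m a k :
  \sum_(i < k.+1) ('C(k, i) * 'C(m, i) * i`!)%:R / fact (a + i) =
  fact (m + a + k) / (fact (m + a) * fact (a + k)).
Proof.
have -> : fact (m + a + k) / (fact (m + a) * fact (a + k)) =
    fact k / fact (a + k) * 'C(m + (a + k), k)%:R.
  by rewrite addnA [(m + a + k)%N]addnC natr_binD; field; rewrite !factR_neq0.
rewrite -binomial.Vandermonde natr_sum mulr_sumr; apply: eq_bigr => i _.
have ik : (i <= k)%N by rewrite -ltnS.
have -> : 'C(a + k, k - i) = 'C(a + k, a + i).
  by rewrite -bin_sub; [congr 'C(_, _); lia|lia].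
rewrite [in RHS]natrM natr_bin_shift !natrM.
by field; rewrite !factR_neq0.
Qed.

(** Multiplied by i! (k-i)! (n-k)!, both sides become n!. *)
Lemma bin_trinomial n k i : (i <= k)%N -> (k <= n)%N ->
  ('C(n, i) * 'C(n - i, k - i) = 'C(n, k) * 'C(k, i))%N.
Proof.
move=> ik kn; apply/eqP; rewrite -(eqn_pmul2r (fact_gt0 i)).
rewrite -(eqn_pmul2r (fact_gt0 (k - i))) -(eqn_pmul2r (fact_gt0 (n - k))).
apply/eqP; have h1 := bin_fact (leq_trans ik kn); have h2 := bin_fact ik.
have h3 := bin_fact kn.
have h4 : ('C(n - i, k - i) * ((k - i)`! * (n - k)`!) = (n - i)`!)%N.
  rewrite -(bin_fact (leq_sub2r i kn)); congr (_ * (_ * _`!))%N; lia.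
transitivity n`!.
  by rewrite -h1 -h4; ring.
by rewrite -h3 -h2; ring.
Qed.

(* Both sides are polynomials in y; the coefficients agree by Vandermonde. *)
Lemma jacobi_sum_expand n m a y :
  \sum_(i < n.+1) (-1) ^+ i * ('C(n, i) * 'C(m, i) * i`!)%:R / fact (a + i) *
    y ^+ i * (1 - y) ^+ (n - i) =
  \sum_(k < n.+1) (-1) ^+ k * 'C(n, k)%:R *
    (fact (m + a + k) / (fact (m + a) * fact (a + k))) * y ^+ k.
Proof.
have expand i : (i <= n)%N -> (- y) ^+ i * (1 - y) ^+ (n - i) =
    \sum_(k < n.+1) (if (i <= k)%N then 'C(n - i, k - i)%:R * (- y) ^+ k else 0).
  move=> ni; symmetry; rewrite -(big_mkord xpredT (fun k =>
    if (i <= k)%N then 'C(n - i, k - i)%:R * (- y) ^+ k else 0)).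
  rewrite (@big_cat_nat _ _ _ i) //=; last by rewrite leqW.
  rewrite big1_seq ?add0r => [|k]; last first.
    by rewrite mem_index_iota => /andP[_ /andP[_]]; rewrite ltnNge => /negPf ->.
  rewrite -{1}(add0n i) big_addn big_mkord exprDn mulr_sumr subSn//.
  apply: eq_bigr => k _; rewrite leq_addl addnK expr1n mul1r exprD -mulr_natl.
  by ring.
transitivity (\sum_(i < n.+1) \sum_(k < n.+1)
    ('C(n, i) * 'C(m, i) * i`!)%:R / fact (a + i) *
   (if (i <= k)%N then 'C(n - i, k - i)%:R * (- y) ^+ k else 0)).
  apply: eq_bigr => i _.
  by rewrite -mulr_sumr -expand ?leq_ord// [(- y) ^+ i]exprNn; ring.
(* In the coefficient of [y ^+ k], [bin_trinomial] takes C(n,k) out of the sum over [i], and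
   [sum_bin_fact] evaluates what remains. *)
rewrite exchange_big; apply: eq_bigr => k _ /=.
rewrite -sum_bin_fact mulr_sumr mulr_suml.
rewrite (big_ord_widen n.+1 (fun i => (-1) ^+ k * 'C(n, k)%:R *
  (('C(k, i) * 'C(m, i) * i`!)%:R / fact (a + i)) * y ^+ k))//.
rewrite [RHS]big_mkcond; apply: eq_bigr => i _; rewrite ltnS.
case: leqP => ik; last by rewrite mulr0.
have /(congr1 (fun x => x%:R : R)) := bin_trinomial ik (leq_ord k).
rewrite !natrM [(- y) ^+ k]exprNn => h.
transitivity ('C(n, i)%:R * 'C(n - i, k - i)%:R *
  ('C(m, i)%:R * i`!%:R / fact (a + i) * ((-1) ^+ k * y ^+ k))); first by ring.
by rewrite h; ring.
Qed.

End Combinatorics.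

(** * Jacobi functions with integer parameters *)

Section JacobiAtIntegers.
Context {R : realType}.
Implicit Types (x y z : R).

Local Notation fact n := (n`!%:R : R).

Lemma pochhammer_succ m k : pochhammer (m%:R + 1) k = fact (m + k) / fact m.
Proof.
elim: k => [|k IH]; first by rewrite /pochhammer big_ord0 addn0 divff ?factR_neq0.
rewrite /pochhammer big_ord_recr -/(pochhammer _ _) IH /= addnS factS natrM.
by rewrite -natr1 natrD; field; rewrite factR_neq0.
Qed.

Lemma pochhammer_opp n k : pochhammer (- n%:R : R) k = (-1) ^+ k * (n ^_ k)%:R.
Proof.
elim: k => [|k IH]; first by rewrite /pochhammer big_ord0 expr0 mulr1.
rewrite /pochhammer big_ord_recr -/(pochhammer _ _) IH /= ffactnSr natrM exprSr.
have [kn|nk] := leqP k n; first by rewrite natrB//; ring.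
by rewrite ffact_small// mulr0 !mul0r mulr0.
Qed.

(** The series terminates, since (-n)_k = 0 for k > n, so its partial sums are eventually
    constant. *)
Lemma hyp2F1_opp n b c z : hyp2F1 (- n%:R) b c z =
  \sum_(k < n.+1) pochhammer (- n%:R) k * pochhammer b k /
    (pochhammer c k * k`!%:R) * z ^+ k.
Proof.
apply: lim_near_cst => //; exists n.+1 => // m /= nm.
rewrite /series /= (@big_cat_nat _ _ _ n.+1) //= big_mkord.
rewrite [X in _ + X]big1_seq ?addr0// => k /=.
rewrite mem_index_iota => /andP[nk _].
by rewrite pochhammer_opp ffact_small// mulr0 !mul0r.
Qed.

(** [jacobi_sum_expand] read from right to left at (1-y)/2; for y = cos 2t the two bases become
    sin^2 t and cos^2 t. *)
Lemma jacobi_nat n a b y : jacobi n a%:R b%:R y =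
  fact (n + a) / fact n *
  \sum_(i < n.+1) (-1) ^+ i * ('C(n, i) * 'C(n + b, i) * i`!)%:R / fact (a + i) *
    ((1 - y) / 2) ^+ i * ((1 + y) / 2) ^+ (n - i).
Proof.
have -> : (1 + y) / 2 = 1 - (1 - y) / 2 by field.
rewrite jacobi_sum_expand /jacobi hyp2F1_opp -!natrD !GammaS.
rewrite !mulr_sumr; apply: eq_bigr => k _.
rewrite !pochhammer_succ pochhammer_opp -bin_ffact natrM.
have -> : (n + b + a = n + a + b)%N by lia.
by field; rewrite !factR_neq0.
Qed.

(** Stated for squares because the real powers in [jacobi_g] give |sin|^a and |cos|^b, whereas the
    right-hand sum carries signed powers. *)
Lemma jacobi_g_cos_sqr n a b theta :
  jacobi_g n a%:R b%:R (cos (2 * theta)) ^+ 2 =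
  fact (n + a) * fact (n + b + a) / (fact n * fact (n + b)) *
    (sin theta ^+ a * jacobi_sum n (n + b) a (cos theta) (sin theta)) ^+ 2.
Proof.
have cE : cos (2 * theta) = cos theta ^+ 2 *+ 2 - 1.
  by rewrite mulr_natl cos_mulr2n.
have sE : (1 - cos (2 * theta)) / 2 = sin theta ^+ 2.
  by rewrite cE sin2cos2; field.
have c2E : (1 + cos (2 * theta)) / 2 = cos theta ^+ 2 by rewrite cE; field.
rewrite /jacobi_g jacobi_nat sE c2E -!natrD !GammaS !exprMn sqr_sqrtr; last first.
  by rewrite divr_ge0 ?mulr_ge0 ?ler0n.
have powE z k : ((z ^+ 2) `^ (k%:R / 2)) ^+ 2 = (z ^+ k) ^+ 2.
  rewrite -powR_mulrn ?powR_ge0// -powRrM divfK// powR_mulrn ?sqr_ge0//.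
  by rewrite exprAC.
rewrite !powE.
have -> : jacobi_sum n (n + b) a (cos theta) (sin theta) = cos theta ^+ b *
    \sum_(i < n.+1) (-1) ^+ i * ('C(n, i) * 'C(n + b, i) * i`!)%:R / fact (a + i) *
      (sin theta ^+ 2) ^+ i * (cos theta ^+ 2) ^+ (n - i).
  rewrite mulr_sumr; apply: eq_bigr => i _.
  have i_n : (i <= n)%N by rewrite -ltnS.
  have -> : (n + (n + b) - i * 2 = b + 2 * (n - i))%N by lia.
  by rewrite exprD [(i * 2)%N]mulnC !exprM; ring.
have -> : (n + b + a = n + a + b)%N by lia.
by field; rewrite !factR_neq0.
Qed.

Lemma powR_sqr_quarter z : (z ^+ 2) `^ (1 / 4) = `|z| `^ (1 / 2).
Proof.
rewrite -[z ^+ 2]real_normK ?num_real// -powR_mulrn// -powRrM.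
by congr (_ `^ _); field.
Qed.

End JacobiAtIntegers.

(** * The extremal coefficients and the central binomial bound *)

Section Sharpness.
Context {R : realType}.

(** The bound C(2m,m) >= 4^m / (2 sqrt m), squared; equality holds at m = 1, the start of the
    induction. *)
Lemma central_bin_ge m : (0 < m)%N ->
  16 ^+ m <= 'C(m + m, m)%:R ^+ 2 * (4 * m%:R) :> R.
Proof.
case: m => // m _; elim: m => [|m IH].
  by rewrite (_ : 'C(1 + 1, 1) = 2%N)//; lra.
have -> : 'C(m.+2 + m.+2, m.+2)%:R =
    'C(m.+1 + m.+1, m.+1)%:R * (2 * (2 * m%:R + 3)) / (m%:R + 2) :> R.
  rewrite !natr_binD addSn addnS !factS !natrM -!natr1 !natrD -!natr1.
  field; rewrite !factR_neq0 /=.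
  have m0 : 0 <= m%:R :> R by rewrite ler0n.
  by rewrite !gt_eqF//; lra.
have m2 : 0 < m%:R + 2 :> R by rewrite ltr_wpDl.
move: IH; rewrite [16 ^+ m.+2]exprSr -[m.+2%:R]natr1 -[m.+1%:R]natr1.
set B := 'C(_, _)%:R => IH.
rewrite -(ler_pM2r (_ : 0 < 16)) in IH; last by [].
apply: (le_trans IH); rewrite -subr_ge0.
(* The excess is positive because (2m+3)^2 = 4(m+1)(m+2) + 1. *)
set r := (X in 0 <= X).
have -> : r = 16 * B ^+ 2 / (m%:R + 2) by rewrite /r; field; rewrite gt_eqF.
by apply: divr_ge0; [rewrite mulr_ge0 ?sqr_ge0 ?ler0n|exact: ltW].
Qed.

(** For q = 0 the Jacobi sum has a single term. *)
Lemma rot_coef_central m (c s : R) :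
  rot_coef (m + m) m 0 c s = (s * c) ^+ m * 'C(m + m, m)%:R.
Proof.
have := @rot_coef_ge R 0 m m c s; rewrite add0n => ->.
rewrite /jacobi_sum big_ord1 natr_binD exprMn /= bin0 !mul1n mul0n add0n subn0.
rewrite addn0 bin0 !expr0 fact0.
by field; rewrite !factR_neq0.
Qed.

(** At pi/4 one has sin cos = 1/2. The fourth power avoids roots and matches the exponent 1/4 to be
    tested. *)
Lemma normc_mcoef_central (ip : forall N : nat, {dot @Pl R N for (@Num.conj R[i])})
    (ip_unitary : forall N : nat, rep_unitary (ip N)) m :
  ComplexField.Normc.normc (mcoef (ip (m + m)%N) (inord m) ord0
    (kmx 0 *m tmx (pi / 4) *m kmx (- 0))) ^+ 4 * 16 ^+ m = 'C(m + m, m)%:R ^+ 2.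
Proof.
have mi : (inord m : 'I_(m + m).+1) = m :> nat by rewrite inordK// ltnS leq_addr.
rewrite (exprM _ 2 2) (normc_mcoef_sqr (ip_unitary _)) normc_rep_coef_rotation mi.
rewrite real_normK ?num_real// rot_coef_central bin0.
have cs : (sin (pi / 4) * cos (pi / 4)) ^+ 4 * 16 = 1 :> R.
  have h : sin (pi / 4) * cos (pi / 4) = 1 / 2 :> R.
    have := sin_mulr2n (pi / 4 : R).
    have -> : (pi / 4) *+ 2 = pi / 2 :> R by rewrite -mulr_natl; field.
    by rewrite sin_pihalf -mulr_natl; lra.
  by rewrite h; field.
have bin_neq0 : 'C(m + m, m)%:R != 0 :> R by rewrite pnatr_eq0 -lt0n bin_gt0 leq_addr.
set B : R := 'C(m + m, m)%:R in bin_neq0 *.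
transitivity (((sin (pi / 4) * cos (pi / 4)) ^+ 4 * 16) ^+ m * B ^+ 2).
  by rewrite [in RHS]exprMn [in RHS]exprAC; field.
by rewrite cs expr1n mul1r.
Qed.

End Sharpness.

Lemma powR_natr_unbounded (R : realType) (r x : R) : 0 < r -> exists m, x < (m.+1%:R) `^ r.
Proof.
(* Passing to [y >= 0] makes the powers [r^-1] and [r] inverse to each other. *)
move=> r0; pose y := Num.max x 0; pose m := Num.bound (y `^ r^-1).
exists m; have yb : y `^ r^-1 < m.+1%:R.
  apply: lt_trans (_ : _ < m%:R) _; last by rewrite ltr_nat.
  exact: archi_boundP (powR_ge0 _ _).
have y0 : 0 <= y by rewrite le_max lexx orbT.
apply: (@le_lt_trans _ _ y); first by rewrite le_max lexx.
have -> : y = (y `^ r^-1) `^ r by rewrite -powRrM mulVf ?gt_eqF// powRr1.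
by rewrite gt0_ltr_powR ?nnegrE ?powR_ge0 ?ler0n.
Qed.

(** * The uniform bound for matrix coefficients and the sharpness of its exponent *)

Theorem theorem2p1 (R : realType)
    (ip : forall N : nat, {dot @Pl R N for (@Num.conj R[i])})
    (ip_unitary : forall N : nat, rep_unitary (ip N)) :
  (forall C : R, 0 < C ->
    (forall (n : nat) (a b x : R), 0 <= a -> 0 <= b -> -1 <= x <= 1 ->
      `|(1 - x ^+ 2) `^ (1 / 4) * jacobi_g n a b x|
        <= C * (2 * n%:R + a + b + 1) `^ (- (1 / 4))) ->
    forall (phi theta psi : R) (N : nat) (p q : 'I_N.+1),
      `|sin (2 * theta)| `^ (1 / 2) *
        ComplexField.Normc.normc
          (mcoef (ip N) p q (kmx phi *m tmx theta *m kmx (- psi)))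
        <= C * (N%:R + 1) `^ (- (1 / 4)))
  /\
  ~ (exists C' : R, exists eps : R, 0 < C' /\ 0 < eps /\
      forall (phi theta psi : R) (N : nat) (p q : 'I_N.+1),
        `|sin (2 * theta)| `^ (1 / 2) *
          ComplexField.Normc.normc
            (mcoef (ip N) p q (kmx phi *m tmx theta *m kmx (- psi)))
          <= C' * (N%:R + 1) `^ (- (1 / 4) - eps)).
Proof.
split.
  move=> C C0 hC phi theta psi N p q.
  have [n [a [b [nab rotE]]]] :=
    rot_coef_sqr (cos theta) (sin theta) (leq_ord p) (leq_ord q).
  have x1 : -1 <= cos (2 * theta) <= 1 by rewrite cos_geN1 cos_le1.
  have := hC n a%:R b%:R (cos (2 * theta)) (ler0n _ _) (ler0n _ _) x1.
  rewrite -natrM -!natrD mulnC nab; congr (_ <= _).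
  rewrite normrM -sin2cos2 powR_sqr_quarter ger0_norm ?powR_ge0//; congr (_ * _).
  (* Both moduli are nonnegative, so it suffices to compare squares, where the signs and phases
     disappear. *)
  apply/eqP; rewrite -(@eqrXn2 _ 2) ?normc_ge0// real_normK ?num_real//.
  rewrite jacobi_g_cos_sqr (normc_mcoef_sqr (ip_unitary N)) normc_rep_coef_rotation.
  by rewrite real_normK ?num_real// rotE.
move=> [C' [eps [C'0 [eps0 hC]]]].
have eps4 : 0 < 4 * eps by rewrite mulr_gt0.
(* The threshold 2 C'^4 is what the final chain of inequalities contradicts. *)
have [k hk] := powR_natr_unbounded (2 * C' ^+ 4) eps4.
pose m := k.+1; pose M : R := (m + m)%N%:R + 1.
have M0 : 0 < M by rewrite ltr_wpDl.
have := hC 0 (pi / 4) 0 (m + m)%N (inord m) ord0.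
have -> : 2 * (pi / 4) = pi / 2 :> R by field.
rewrite sin_pihalf normr1 powR1 mul1r -/M; set x : R := ComplexField.Normc.normc _.
have x0 : 0 <= x by exact: normc_ge0.
move=> hx.
(* Fourth power of the assumed bound, with M = N + 1 = 2m + 1. *)
have hx4 : x ^+ 4 * (M * M `^ (4 * eps)) <= C' ^+ 4.
  have hM : (M `^ (- (1 / 4) - eps)) ^+ 4 * (M * M `^ (4 * eps)) = 1.
    rewrite -powR_mulrn ?powR_ge0// -powRrM -[X in _ * (X * _)]powRr1 ?ltW//.
    rewrite -!powRD ?(gt_eqF M0) ?implybT//.
    by rewrite [X in _ `^ X](_ : _ = 0) ?powRr0//; field.
  apply: (@le_trans _ _ ((C' * M `^ (- (1 / 4) - eps)) ^+ 4 * (M * M `^ (4 * eps)))).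
    rewrite ler_pM2r ?mulr_gt0 ?powR_gt0//.
    by rewrite lerXn2r ?nnegrE// mulr_ge0 ?powR_ge0// ltW.
  by rewrite exprMn -mulrA hM mulr1.
have x4 := normc_mcoef_central ip_unitary m; rewrite -/x in x4.
have cb := @central_bin_ge R m isT; rewrite -x4 in cb.
have hx4' : 1 <= x ^+ 4 * (4 * m%:R).
  by rewrite -(ler_pM2l (_ : 0 < 16 ^+ m)) ?exprn_gt0// mulr1; lra.
have hkM : 2 * C' ^+ 4 < M `^ (4 * eps).
  apply: (lt_le_trans hk); rewrite ge0_ler_powR ?nnegrE ?ltW//.
  by rewrite /M natr1 ltr_nat /m; lia.
have M4 : 4 * m%:R <= 2 * M by rewrite /M natrD; lra.
(* From 1 <= 4m x^4 <= 2M x^4, multiplication by M^(4 eps) gives M^(4 eps) <= 2 C'^4, against the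
   choice of [m]. *)
have := ler_wpM2l (exprn_ge0 4 x0) M4.
move/(le_trans hx4')/(ler_wpM2r (powR_ge0 M (4 * eps))).
move: hx4 hkM; set P := M `^ _; set D := C' ^+ 4; set y := x ^+ 4.
rewrite mul1r (_ : y * (2 * M) * P = 2 * (y * (M * P))); last by ring.
by move: (y * _) => z; lra.
Qed.
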